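(* Let $(X,\preceq,G)$ be a complete partially ordered $G$-metric space and let $T:X\to X$ be a mapping satisfying the following conditions: 1. $T$ is $G$-continuous or $(X,\preceq,G)$ is regular non-decreasing; 2. $T$ is non-decreasing; 3. there exists $x_0\in X$ with $x_0\preceq Tx_0$; 4. there exist $\psi\in\Psi$ and $\phi\in\Phi$ such that for all $x,y,z\in X$ with $x\preceq y\preceq z$, $$\psi(G(Tx,Ty,Tz))\le \psi(M(x,y,z))-\phi(M(x,y,z)),$$ where $$M(x,y,z)=\max\Big\{G(x,Tx,y),\,G(x,Tx,z),\,G(x,y,z),\,G(y,Ty,Ty),\,G(z,Tz,Tz),\,\tfrac12\big[G(x,Ty,Tz)+G(Tx,y,z)\big]\Big\}.$$ Then $T$ has a fixed point.
   Context: A $G$-metric on a nonempty set $X$ is a function $G:X\times X\times X\to[0,\infty)$ such that: (G1) $G(x,y,z)=0$ if $x=y=z$; (G2) $0<G(x,x,y)$ for all $x,y\in X$ with $x\ne y$; (G3) $G(x,x,y)\le G(x,y,z)$ for all $x,y,z\in X$ with $y\neq z$; (G4) $G$ is invariant under all permutations of its three arguments; (G5) $G(x,y,z)\le G(x,a,a)+G(a,y,z)$ for all $x,y,z,a\in X$. A partially ordered $G$-metric space $(X,\preceq,G)$ is a nonempty set $X$ with a partial order $\preceq$ and a $G$-metric $G$. A sequence $(x_n)$ $G$-converges to $x$ if $G(x,x_n,x_m)\to0$ as $n,m\to\infty$; it is $G$-Cauchy if $G(x_n,x_m,x_l)\to 0$ as $n,m,l\to\infty$; the space is complete if every $G$-Cauchy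 sequence $G$-converges to some point of $X$. $T$ is $G$-continuous if $x_n\to x$ implies $Tx_n\to Tx$ (in the sense of $G$-convergence). $T$ is non-decreasing if $x\preceq y$ implies $Tx\preceq Ty$. $(X,\preceq,G)$ is regular non-decreasing if for every $\preceq$-non-decreasing sequence $(x_n)$ in $X$ with $x_n\to x^*$ one has $x_n\preceq x^*$ for all $n\in\mathbb N$. $\Psi$ is the set of functions $\psi:[0,\infty)\to[0,\infty)$ that are continuous, non-decreasing and satisfy $\psi(t)=0$ iff $t=0$. $\Phi$ is the set of functions $\phi:[0,\infty)\to[0,\infty)$ that are lower semi-continuous and satisfy $\phi(t)=0$ iff $t=0$. *)

(* Defs.v *)
From mathcomp Require Import all_boot all_order all_algebra.
From mathcomp Require Import all_classical all_reals all_analysis.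
Set Implicit Arguments.
Unset Strict Implicit.
Unset Printing Implicit Defensive.
Import Order.TTheory GRing.Theory Num.Theory.
Import numFieldNormedType.Exports.

Local Open Scope classical_set_scope.
Local Open Scope ring_scope.

Record is_gmetric (R : realType) (X : Type) (G : X -> X -> X -> R) : Prop :=
  IsGMetric {
    gmetric_ge0 : forall x y z, 0 <= G x y z ;
    gmetric_xxx : forall x, G x x x = 0 ;
    gmetric_gt0 : forall x y, x <> y -> 0 < G x x y ;
    gmetric_le : forall x y z, y <> z -> G x x y <= G x y z ;
    gmetric_sym : forall x y z,
      [/\ G x y z = G x z y, G x y z = G y x z, G x y z = G y z x,
          G x y z = G z x y & G x y z = G z y x] ;
    gmetric_rect : forall x y z a, G x y z <= G x a a + G a y z
  }.

Section gspace.
Variables (R : realType) (X : Type) (G : X -> X -> X -> R).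

Definition gcvg (u : nat -> X) (x : X) : Prop :=
  G x (u n.1) (u n.2) @[n --> (\oo, \oo)] --> (0 : R).

Definition gcauchy (u : nat -> X) : Prop :=
  G (u n.1.1) (u n.1.2) (u n.2) @[n --> ((\oo, \oo), \oo)] --> (0 : R).

Definition gcomplete : Prop :=
  forall u : nat -> X, gcauchy u -> exists x, gcvg u x.

Definition gcontinuous (T : X -> X) : Prop :=
  forall (u : nat -> X) (x : X), gcvg u x -> gcvg (T \o u) (T x).

End gspace.

Definition gregular_nondecreasing (R : realType) (d : Order.disp_t)
    (X : porderType d) (G : X -> X -> X -> R) : Prop :=
  forall (u : nat -> X) (x : X),
    nondecreasing_seq u -> gcvg G u x -> forall n, (u n <= x)%O.

(* Functions [0, +oo[ -> [0, +oo[ are represented by functions on R of which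
   only the restriction to [0, +oo[ matters. *)
Definition Psi (R : realType) : set (R -> R) := [set psi : R -> R |
  [/\ forall t, 0 <= t -> 0 <= psi t,
      {within `[0, +oo[, continuous psi},
      {in `[0, +oo[ &, {homo psi : s t / s <= t}} &
      forall t, 0 <= t -> (psi t = 0 <-> t = 0)]].

(* As in {within A, continuous f}, lower semi-continuity relative to [0, +oo[
   is lower semi-continuity for the topology of subspace `[0, +oo[, in which
   the points outside [0, +oo[ are isolated. *)
Definition Phi (R : realType) : set (R -> R) := [set phi : R -> R |
  [/\ forall t, 0 <= t -> 0 <= phi t,
      lower_semicontinuous
        (fun t : subspace (`[0, +oo[ : set R) => (phi t)%:E) &
      forall t, 0 <= t -> (phi t = 0 <-> t = 0)]].

Definition gM (R : realType) (X : Type) (G : X -> X -> X -> R) (T : X -> X)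
    (x y z : X) : R :=
  Num.max (G x (T x) y) (Num.max (G x (T x) z) (Num.max (G x y z)
    (Num.max (G y (T y) (T y)) (Num.max (G z (T z) (T z))
      ((G x (T y) (T z) + G (T x) y z) / 2))))).

(* Main.v *)
(** The iterates [x n] of [x0] form a non-decreasing sequence. If
    [psi a <= psi b - phi b], then [a] and [b] cannot both be close to a given
    [e > 0]. This is used three times: with the limit of
    [G (x n) (x n.+1) (x n.+1)], which must therefore vanish; with the first
    value [G (x n) (x n) (x m.+1) >= e], for which the contraction at
    [(x n, x n, x m)] compares two numbers close to [e], so that [x] is
    G-Cauchy; and with [G l (T l) (T l)] when [l] is the limit of [x] and is an
    upper bound of [x], by the contraction at [(x n, l, l)]. *)
Require Import Defs.
From mathcomp Require Import all_boot all_order all_algebra.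
From mathcomp Require Import all_classical all_reals all_analysis.
From mathcomp Require Import lra.
Import Order.TTheory GRing.Theory Num.Theory.
Import numFieldNormedType.Exports.
Local Open Scope classical_set_scope.
Local Open Scope ring_scope.

(** At [e] itself the two sides differ by [phi e > 0]. Near [e], continuity keeps [psi a] and
    [psi b] within [phi e / 4] of [psi e], while lower semi-continuity keeps [phi b] above
    [phi e / 2], so the strict inequality survives. *)
Lemma psi_sub_phi_lt (R : realType) (psi phi : R -> R) (e : R) :
  Psi psi -> Phi phi -> 0 < e ->
  exists2 d : R, 0 < d & forall a b, 0 <= a -> 0 <= b ->
    `|e - a| < d -> `|e - b| < d -> psi b - phi b < psi a.
Proof.
move=> [_ psi_cont _ _] [phi_ge0 phi_lsc phi_eq0] e0.
have Ae : `[0, +oo[%classic e by rewrite /= in_itv /= andbT ltW.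
have phie : 0 < phi e.
  rewrite lt_neqAle phi_ge0 ?(ltW e0)// andbT eq_sym.
  by apply/eqP => /(phi_eq0 _ (ltW e0)) ee; rewrite ee ltxx in e0.
have psi_near : \forall t \near nbhs e, `[0, +oo[%classic t ->
    `|psi e - psi t| < phi e / 4.
  have /subspace_continuousP/(_ _ Ae)/cvgrPdist_lt := psi_cont.
  by apply; rewrite divr_gt0.
have phi_near : \forall t \near nbhs e, `[0, +oo[%classic t ->
    phi e / 2 < phi t.
  have [|V] := phi_lsc e (phi e / 2); first by rewrite lte_fin; lra.
  move=> nV phiV.
  have {}nV : \forall t \near nbhs e, `[0, +oo[%classic t -> V t.
    by move: nV; rewrite /nbhs /= -(nbhs_subspace_in Ae).
  by apply: filterS nV => t Vt /Vt /phiV; rewrite lte_fin.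
have [d /= d0 dP] := (nbhs_ballP e _).1 (filterI psi_near phi_near).
exists d => // a b a0 b0 /dP[/= + _] /dP[/=].
rewrite !in_itv /= !andbT => /(_ a0) + /(_ b0) + /(_ b0).
by rewrite !ltr_distl => /andP[? ?] /andP[? ?] ?; lra.
Qed.

Section gmetric.
Context {R : realType} {X : Type} {G : X -> X -> X -> R}.
Hypothesis gG : is_gmetric G.

Lemma gmetricCA x y z : G x y z = G y x z.
Proof. by have [] := gmetric_sym gG x y z. Qed.

Lemma gmetricAC x y z : G x y z = G x z y.
Proof. by have [] := gmetric_sym gG x y z. Qed.

Lemma gmetric_rect3 x y z a : G x y z <= G z a a + G x y a.
Proof.
rewrite (gmetricAC x y z) gmetricCA (gmetricAC x y a) (gmetricCA x a y).
exact: gmetric_rect.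
Qed.

(** [G x y y] need not be symmetric in its two points; the factor 2 is the price of exchanging
    them. *)
Lemma gmetric_le2 x y : G x y y <= 2 * G y x x.
Proof.
rewrite gmetricCA gmetricAC; have := gmetric_rect gG y y x x.
by rewrite (gmetricCA x y x); lra.
Qed.

Lemma gmetric_eq0 x y : G x y y = 0 -> x = y.
Proof.
move=> xy0; apply: contrapT => xy; have := gmetric_gt0 gG (nesym xy).
by rewrite gmetricAC gmetricCA xy0 ltxx.
Qed.

Lemma gcvgP (u : nat -> X) x : gcvg G u x -> forall e, 0 < e ->
  exists N, forall n m, (N <= n)%N -> (N <= m)%N -> G x (u n) (u m) < e.
Proof.
move=> /cvgrPdist_lt ux e /ux[[A B] /= [[N1 _ AN] [N2 _ BN]] AB].
exists (maxn N1 N2) => n m; rewrite !geq_max => /andP[nN _] /andP[_ mN].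
have := AB (n, m) (conj (AN n nN) (BN m mN)).
by rewrite /= sub0r normrN ger0_norm// gmetric_ge0.
Qed.

(** Two rectangle inequalities through [u N] split [G (u n) (u m) (u l)] into three terms, each
    comparing [u N] with one later point. *)
Lemma gcauchyW (u : nat -> X) :
  (forall e, 0 < e -> exists N, forall m, (N <= m)%N ->
    G (u N) (u N) (u m) < e) ->
  gcauchy G u.
Proof.
move=> uP; apply/cvgrPdist_lt => e e0.
have [|N uN] := uP (e / 3); first by rewrite divr_gt0.
have nN : \forall n \near \oo, (N <= n)%N by exists N.
exists ([set p | (N <= p.1)%N /\ (N <= p.2)%N], [set n | (N <= n)%N]).
  split => //=; exists ([set n | (N <= n)%N], [set n | (N <= n)%N]) => //=.
move=> [[n m] l] /= [[/uN + /uN +] /uN].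
rewrite sub0r normrN ger0_norm ?(gmetric_ge0 gG)//.
have := gmetric_rect gG (u n) (u m) (u l) (u N).
have := gmetric_rect gG (u m) (u N) (u l) (u N).
rewrite (gmetricCA (u m) (u N)) (gmetricAC (u N) _ (u n)) (gmetricCA _ (u n)).
by rewrite (gmetricAC (u N) _ (u m)) (gmetricCA _ (u m) (u N)); lra.
Qed.

Lemma gcvg_lim_eq (u : nat -> X) x y :
  gcvg G u x -> gcvg G (fun n => u n.+1) y -> x = y.
Proof.
move=> /gcvgP ux /gcvgP uy; apply: gmetric_eq0.
apply/eqP; rewrite eq_le gmetric_ge0// andbT; apply/ler_addgt0Pl => e e0.
(* For a late term [z], [G x y y] is at most [G x z z + 2 * G y z z], hence thirds of [e]. *)
have [|N uN] := ux (e / 3); first by rewrite divr_gt0.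
have [|N' uN'] := uy (e / 3); first by rewrite divr_gt0.
have NN' := leqW (leq_maxl N N').
have := uN _ _ NN' NN'.
have := uN' (maxn N N') (maxn N N') (leq_maxr _ _) (leq_maxr _ _).
set z := u _; have := gmetric_rect gG x y y z.
by have := gmetric_le2 z y; lra.
Qed.

Lemma le_gM (T : X -> X) x y z : G x y z <= gM G T x y z.
Proof. by rewrite /gM !le_max lexx !orbT. Qed.

Lemma gM_lt (T : X -> X) x y z c :
  G x (T x) y < c -> G x (T x) z < c -> G x y z < c ->
  G y (T y) (T y) < c -> G z (T z) (T z) < c ->
  G x (T y) (T z) + G (T x) y z < 2 * c -> gM G T x y z < c.
Proof.
move=> c1 c2 c3 c4 c5 c6; rewrite /gM !gt_max c1 c2 c3 c4 c5 /=.
by rewrite ltr_pdivrMr// mulrC.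
Qed.

End gmetric.

Section orbit.
Context {R : realType} {d : Order.disp_t} {X : porderType d}.
Context {G : X -> X -> X -> R} {T : X -> X} {psi phi : R -> R} {x : nat -> X}.
Hypotheses (gG : is_gmetric G) (psiP : Psi psi) (phiP : Phi phi).
Hypothesis contr : forall a b c : X, (a <= b)%O -> (b <= c)%O ->
  psi (G (T a) (T b) (T c)) <= psi (gM G T a b c) - phi (gM G T a b c).
Hypotheses (xS : forall n, x n.+1 = T (x n)) (x_ndec : nondecreasing_seq x).

Let gM_ge0 a b c : 0 <= gM G T a b c.
Proof. exact: le_trans (gmetric_ge0 gG a b c) (le_gM _ _ _ _). Qed.

Lemma contr_gap e : 0 < e -> exists2 h : R, 0 < h &
  forall a b c : X, (a <= b)%O -> (b <= c)%O ->
    `|e - G (T a) (T b) (T c)| < h -> `|e - gM G T a b c| < h -> False.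
Proof.
move=> /(psi_sub_phi_lt _ _ _ _ psiP phiP)[h h0 hP]; exists h => // a b c ab bc.
move=> /(hP _ _ (gmetric_ge0 gG _ _ _) (gM_ge0 _ _ _))/[apply].
by rewrite ltNge contr.
Qed.

Let step n := G (x n) (x n.+1) (x n.+1).

(** The averaged term reduces to half of [G (x n) (x n.+2) (x n.+2)], which is at most the mean of
    the two steps, hence at most the larger one. *)
Lemma gM_step n : gM G T (x n) (x n.+1) (x n.+1) = Num.max (step n) (step n.+1).
Proof.
have tri : G (x n) (x n.+2) (x n.+2) <= step n + step n.+1.
  exact: gmetric_rect.
rewrite /gM -!xS (gmetric_xxx gG) addr0 -!/(step _).
apply/eqP; rewrite eq_le !ge_max !le_max !lexx !orbT /=.
rewrite ler_pdivrMr//; have [|] := leP (step n) (step n.+1); lra.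
Qed.

(** If the step grew, [gM_step] would make both arguments of [psi] in the contraction equal to
    [step n.+1 > 0]. *)
Lemma step_noninc n : step n.+1 <= step n.
Proof.
rewrite leNgt; apply/negP => lt_step.
have [|h h0 hP] := contr_gap (step n.+1).
  exact: le_lt_trans (gmetric_ge0 gG _ _ _) lt_step.
apply: (hP _ _ _ (x_ndec _ _ (leqnSn n)) (lexx _)).
  by rewrite -!xS subrr normr0.
by rewrite gM_step max_r ?(ltW lt_step)// subrr normr0.
Qed.

Lemma step_cvg0 e : 0 < e -> exists N, forall n, (N <= n)%N -> step n < e.
Proof.
move=> e0.
have step_ge0 n : 0 <= step n := gmetric_ge0 gG _ _ _.
have noninc : nonincreasing_seq step.
  by apply/nonincreasing_seqP => n; exact: step_noninc.
have hinf : has_inf (range step).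
  by split; [exists (step 0), 0%N | exists 0 => _ [n _ <-]].
have inf_le n : inf (range step) <= step n.
  by apply: ge_inf; [exact: hinf.2 | exists n].
have inf_lt h : 0 < h -> exists N, forall n, (N <= n)%N ->
    step n < inf (range step) + h.
  move=> /(inf_adherent)/(_ hinf)[_ [N _ <-] hN].
  by exists N => n /noninc/le_lt_trans; exact.
(* The infimum is the limit of the steps; were it positive, [step N.+1] and the maximum [step N]
   would both be within [h] of it. *)
suff inf0 : inf (range step) <= 0.
  by have [N hN] := inf_lt _ e0; exists N => n /hN; lra.
rewrite leNgt; apply/negP => /contr_gap[h h0 hP]; have [N hN] := inf_lt _ h0.
apply: (hP _ _ _ (x_ndec _ _ (leqnSn N)) (lexx _)).
  rewrite -!xS -/(step _) ltr_distl; have := hN N.+1 (leqnSn N).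
  by have := inf_le N.+1; lra.
rewrite gM_step max_l ?step_noninc// ltr_distl; have := hN N (leqnn N).
by have := inf_le N; lra.
Qed.

Lemma orbit_gcauchy : gcauchy G x.
Proof.
apply: (gcauchyW gG) => e e0; have [h h0 hP] := contr_gap e e0.
(* With all steps from [N] on below [k], and reversed ones below [2 * k], the estimates below leave
   [e] by at most [6 * k], which is less than [h]. *)
have [|N stepN] := step_cvg0 (Num.min e h / 8).
  by rewrite divr_gt0// lt_min e0.
exists N; elim => [|m IH].
  by rewrite leqn0 => /eqP ->; rewrite gmetric_xxx.
rewrite leq_eqVlt => /predU1P[<-|]; first by rewrite gmetric_xxx.
rewrite ltnS => Nm; have {IH} := IH Nm.
(* First exit: one small step takes the distance from below [e] to at least [e], so both values are
   close to [e]. *)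
move=> lt_e; rewrite ltNge; apply/negP => ge_e.
set k := Num.min e h / 8 in stepN.
have [ke kh] : 8 * k <= e /\ 8 * k <= h.
  by rewrite /k mulrC divfK// !ge_min !lexx orbT.
move: (stepN N (leqnn N)) (stepN m Nm) (x_ndec _ _ Nm) (hP (x N) (x N) (x m)).
rewrite /step !xS in ge_e *.
move: (x N) (x m) lt_e ge_e => a b lt_e ge_e sa sb ab.
move=> /(_ (lexx _) ab) absurd.
have sa' := gmetric_le2 gG (T a) a; have sb' := gmetric_le2 gG (T b) b.
have lt_e' := gmetric_rect3 gG a a (T b) b.
have Tab1 := gmetric_rect gG a a (T b) (T a).
have Tab2 := gmetric_rect gG a (T a) (T b) (T a).
have Tab3 := gmetric_rect gG (T a) (T a) (T b) a.
have Tab4 := gmetric_rect gG (T a) a (T b) a.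
have Tab5 := gmetric_rect gG (T a) a b a.
have C1 := gmetricCA gG a (T a) (T b); have C2 := gmetricCA gG a (T a) b.
have C3 : G a (T a) a = G (T a) a a by rewrite gmetricCA.
apply: absurd; rewrite ltr_distl; apply/andP; split; try lra.
  by rewrite ltrBlDr; apply: gM_lt; lra.
by have := le_gM (G := G) T a a b; lra.
Qed.

(** Both [x n] and [T (x n)] approach [l], so [G (T (x n)) (T l) (T l)] approaches
    [G l (T l) (T l)], which is itself a term of the maximum and in the limit its largest. *)
Lemma orbit_ub_fixed l : gcvg G x l -> (forall n, (x n <= l)%O) -> T l = l.
Proof.
move=> /(gcvgP gG) xl ub; apply/esym/(gmetric_eq0 gG)/eqP.
rewrite eq_le gmetric_ge0// andbT leNgt; apply/negP.
set A := G l (T l) (T l) => A0; have [h h0 hP] := contr_gap A A0.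
set k := Num.min A h / 8.
have k0 : 0 < k by rewrite divr_gt0// lt_min A0.
have [kA kh] : 8 * k <= A /\ 8 * k <= h.
  by rewrite /k mulrC divfK// !ge_min !lexx orbT.
have [N xN] := xl k k0.
have := xN N N.+1 (leqnn N) (leqnSn N).
have := xN N.+1 N.+1 (leqnSn N) (leqnSn N).
have := xN N N (leqnn N) (leqnn N).
have := hP _ _ _ (ub N) (lexx l); rewrite xS.
move: (x N) => a absurd ka kTa kaTa.
have al := gmetric_le2 gG a l; have Tal := gmetric_le2 gG (T a) l.
have r1 := gmetric_rect gG a (T l) (T l) l.
have r2 := gmetric_rect gG (T a) (T l) (T l) l.
have r3 := gmetric_rect gG l (T l) (T l) (T a).
have C : G a (T a) l = G l a (T a) by rewrite (gmetricAC gG) gmetricCA.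
have M1 : A <= gM G T a l l by rewrite /gM !le_max lexx !orbT.
rewrite -/A in r1 r2 r3.
apply: absurd; rewrite ltr_distl; apply/andP; split; try lra.
by rewrite ltrBlDr; apply: gM_lt; rewrite -?/A; lra.
Qed.

End orbit.

Theorem theorem2p1 (R : realType) (d : Order.disp_t) (X : porderType d)
    (G : X -> X -> X -> R) (T : X -> X)
    (X_neq0 : [set: X] !=set0)
    (Ggmetric : is_gmetric G)
    (Gcomplete : gcomplete G)
    (Tcont_or_reg : gcontinuous G T \/ gregular_nondecreasing G)
    (Thomo : {homo T : x y / (x <= y)%O})
    (Tx0 : exists x0 : X, (x0 <= T x0)%O)
    (Tcontr : exists psi phi : R -> R,
      [/\ Psi psi, Phi phi &
          forall x y z : X, (x <= y)%O -> (y <= z)%O ->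
            psi (G (T x) (T y) (T z)) <=
            psi (gM G T x y z) - phi (gM G T x y z)]) :
  exists x : X, T x = x.
Proof.
have [x0 x0T] := Tx0; have [psi [phi [psiP phiP contr]]] := Tcontr.
pose x n := iter n T x0.
have xS n : x n.+1 = T (x n) by [].
have x_ndec : nondecreasing_seq x.
  by apply/nondecreasing_seqP; elim => // n; exact: Thomo.
have [l xl] := Gcomplete x (orbit_gcauchy Ggmetric psiP phiP contr xS x_ndec).
exists l; case: Tcont_or_reg => [Tcont|Xreg].
  (* [T \o x] is the shift of [x], and by continuity it tends to [T l]. *)
  exact/esym/(gcvg_lim_eq Ggmetric _ _ _ xl)/Tcont.
exact: (orbit_ub_fixed Ggmetric psiP phiP contr xS _ xl (Xreg _ _ x_ndec xl)).
Qed.
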